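(* Let $\mathcal{A}=\{[x,y)\colon x,y\in\mathbb{R},\ x<y\}\cup\{(x,y)\colon x,y\in\mathbb{Q}\}$. Then the Sorgenfrey line $\mathbb{S}$ is not $\mathcal{A}$-stratifiable.
   Context: The Sorgenfrey line $\mathbb{S}$ is the real line with the topology generated by the intervals $[a,b)$. For a $T_0$-space $X$ and a family $\mathcal{B}$ of open subsets of $X$, the space $X$ is called $\mathcal{B}$-stratifiable if there exists a family of functions $\{f_U\colon U\in\mathcal{B}\}$, $f_U\colon X\to[0,1]$, such that: (1) $U=f_U^{-1}((0,1])$ for every $U\in\mathcal{B}$; (2) if $U,V\in\mathcal{B}$ and $U\subseteq V$, then $f_U(x)\leqslant f_V(x)$ for every $x\in X$; (3) each $f_U$ is continuous. *)

(* Defs.v *)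
From HB Require Import structures.
From mathcomp Require Import all_boot all_order all_algebra finmap.
From mathcomp Require Import all_classical all_reals all_analysis.
Import Order.TTheory GRing.Theory Num.Theory.
Import numFieldNormedType.Exports.

Set Implicit Arguments.
Unset Strict Implicit.
Unset Printing Implicit Defensive.

Local Open Scope classical_set_scope.
Local Open Scope ring_scope.

(* [sorgenfrey R] is an alias of [R] that does not inherit the usual topology
   of [R]: its topology has the intervals [a, b) as a subbase. *)
Definition sorgenfrey (R : realType) : Type := R.

HB.instance Definition _ (R : realType) := Choice.copy (sorgenfrey R) R.

HB.instance Definition _ (R : realType) :=
  @isSubBaseTopological.Build (sorgenfrey R) (R * R)%type
    [set ab : R * R | ab.1 < ab.2] (fun ab => `[ab.1, ab.2[%classic : set R).

Lemma open_sorgenfrey_co (R : realType) (a b : R) : a < b ->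
  @open (sorgenfrey R) `[a, b[%classic.
Proof.
move=> ab; exists [set `[a, b[%classic]; last by rewrite bigcup_set1.
move=> _ ->; exists [fset (a, b)]%fset.
  by move=> i; rewrite !inE => /eqP ->.
rewrite predeqE => t; split=> [/(_ (a, b))|tab i]; first by apply; rewrite /= inE.
by rewrite /= inE => /eqP ->.
Qed.

Lemma open_sorgenfrey_oo (R : realType) (a b : R) :
  @open (sorgenfrey R) `]a, b[%classic.
Proof.
have -> : `]a, b[%classic = \bigcup_(c in `]a, b[%classic) `[c, b[%classic.
  rewrite predeqE => t; split=> [tab|[c]].
    by exists t => //; move: tab; rewrite /= !in_itv /= lexx => /andP[].
  rewrite /= !in_itv /= => /andP[ac _] /andP[ct ->].
  by rewrite (lt_le_trans ac ct).
apply: (@bigcup_open (sorgenfrey R)) => c.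
by rewrite /= in_itv /= => /andP[_ cb]; exact: open_sorgenfrey_co.
Qed.

Lemma kolmogorov_sorgenfrey (R : realType) : kolmogorov_space (sorgenfrey R).
Proof.
have lt_sep (x y : R) : x < y ->
    (`[x, y[%classic : set (sorgenfrey R)) \in nbhs (x : sorgenfrey R) /\
    (y : sorgenfrey R) \in ~` (`[x, y[%classic : set (sorgenfrey R)).
  move=> xy; split; rewrite inE.
    apply: (@open_nbhs_nbhs (sorgenfrey R)); split.
      exact: open_sorgenfrey_co.
    by rewrite /= in_itv /= lexx xy.
  by rewrite /= in_itv /= ltxx andbF.
move=> x y xy; have [lt_xy|lt_yx|eq_xy] := @ltgtP _ R x y.
- by exists `[(x : R), y[%classic; left; exact: lt_sep.
- by exists `[(y : R), x[%classic; right; exact: lt_sep.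
- by move: xy; rewrite eq_xy eqxx.
Qed.

Arguments kolmogorov_sorgenfrey : clear implicits.

(* The separation axiom and the openness of the members of [B] are
   preconditions of the notion: they are taken as arguments, so that the
   negation of [stratifiable] denies only the existence of the functions.
   The values of [f] outside [B] are irrelevant. *)
Definition stratifiable (R : realType) (X : topologicalType)
    (T0X : kolmogorov_space X) (B : set (set X)) (openB : B `<=` open) : Prop :=
  exists f : set X -> X -> R,
    [/\ forall U, B U -> forall x, 0 <= f U x <= 1,
        forall U, B U -> U = f U @^-1` `]0, 1],
        forall U V, B U -> B V -> U `<=` V -> forall x, f U x <= f V x
      & forall U, B U -> continuous (f U)].

Arguments stratifiable R {X} T0X B openB.

Definition sorgenfrey_family (R : realType) : set (set (sorgenfrey R)) :=
  [set U | (exists x y : R, x < y /\ U = `[x, y[%classic) \/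
           (exists p q : rat, U = `](ratr p : R), ratr q[%classic)].

Arguments sorgenfrey_family : clear implicits.

Lemma sorgenfrey_family_open (R : realType) : sorgenfrey_family R `<=` open.
Proof.
move=> U [[x [y [xy ->]]]|[p [q ->]]].
  exact: open_sorgenfrey_co.
exact: open_sorgenfrey_oo.
Qed.

Arguments sorgenfrey_family_open : clear implicits.

(* Main.v *)
Require Import Defs.
From mathcomp Require Import all_boot all_order all_algebra.
From mathcomp Require Import all_classical all_reals all_analysis.
Import Order.TTheory GRing.Theory Num.Theory.
Import numFieldNormedType.Exports.

Local Open Scope classical_set_scope.
Local Open Scope ring_scope.

(* Every real x has g x := f_[x, x + 1) (x) > 0, so by the Baire category
   theorem some set A = {x | 1/(n+1) < g x} is (Euclidean) dense in a nonempty
   open set; pick a rational p there. Put U = (p, p + 2). Since f_U (p) = 0 and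
   f_U is right-continuous at p, f_U < 1/(n+1) just to the right of p. But A
   has points x there, and [x, x + 1) is included in U, so that
   1/(n+1) < g x <= f_U (x). *)

(** If every closure had empty interior, the complements of the closures would be open and dense,
    and Baire would yield a point lying in no [A n]. *)
Lemma Baire_cover (K : realType) (U : completeNormedModType K)
    (A : (set U)^nat) :
  \bigcup_n A n = setT -> exists n, (closure (A n))^° !=set0.
Proof.
move=> Acover; apply: contrapT => /forallNP Anwd.
have odA n : open (~` closure (A n)) /\ dense (~` closure (A n)).
  split; first exact/closed_openC/closed_closure.
  move=> O [x Ox] oO; apply: contrapT => OA; apply: (Anwd n); exists x.
  rewrite /interior; apply: (@filterS _ _ _ O); last exact: open_nbhs_nbhs.
  by move=> y Oy; apply: contrapT => Ay; apply: OA; exists y.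
have [|x [_ Fx]] := Baire odA _ openT; first by exists 0.
have [n _ Anx] : (\bigcup_n A n) x by rewrite Acover.
exact: (Fx n I (subset_closure Anx)).
Qed.

(** Turns Sorgenfrey continuity at [p] into a Euclidean limit from the right: an interval [a, b)
    containing [p] contains all points just to the right of [p]. *)
Lemma cvg_sorgenfrey_at_right (R : realType) (p : R) :
  p^'+ --> (p : sorgenfrey R).
Proof.
move=> W; rewrite /= nbhsE => -[V [[D' sub <-] [S D'S Sp]] VW].
(* [S] is a basic open set around [p]: the intersection of the finitely many intervals [a, b)
   indexed by [F]. *)
apply: filterS VW _; have [F sF FE] := sub _ D'S.
apply: (@filterS _ _ _ S); first by move=> x Sx; exists S.
rewrite -FE; apply: filter_bigI => -[a b] Fab.
have : S p by [].
rewrite -FE => /(_ _ Fab); rewrite /= in_itv /= => /andP[ap pb].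
near=> t; rewrite /= in_itv /=; apply/andP; split.
  by apply: (le_trans ap); near: t; exact: nbhs_right_ge.
by near: t; exact: nbhs_right_lt.
Unshelve. all: by end_near. Qed.

Lemma ratr_dense_open (R : realType) (O : set R) :
  open O -> O !=set0 -> exists q : rat, O (ratr q).
Proof.
move=> oO [x Ox]; have /nbhs_ballP[e /= e0 xeO] : nbhs x O.
  exact: open_nbhs_nbhs.
have [q] := @rat_in_itvoo R x (x + e) ltac:(by rewrite ltrDl).
rewrite in_itv /= => /andP[xq qxe]; exists q; apply: xeO.
by rewrite /ball /= distrC gtr0_norm ?subr_gt0// ltrBlDl.
Qed.

(** Near [p], points to the right of [p] satisfy [P] and lie in the closure of [A]. One of them,
    [p + e / 2], has a neighbourhood inside that one-sided region, and [A] must meet it. *)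
Lemma closure_at_right (R : realType) (A P : set R) (p : R) :
  (closure A)^° p -> (\forall x \near p^'+, P x) -> exists2 x, A x & P x.
Proof.
move=> Ap; rewrite /at_right near_withinE => Pp.
have /nbhs_ballP[e /= e0 pe] : \forall x \near p, closure A x /\ (p < x -> P x).
  by near=> x; split; near: x.
have pB : ball p e (p + e / 2).
  rewrite /ball /= opprD addNKr normrN gtr0_norm ?divr_gt0//.
  by rewrite ltr_pdivrMr// ltr_pMr// ltr1n.
have [clA _] := pe _ pB.
have : nbhs (p + e / 2) (ball p e `&` [set x | p < x]).
  apply: filterI; first by apply: open_nbhs_nbhs; split; [exact: ball_open|].
  by apply: lt_nbhsr; rewrite ltrDl divr_gt0.
by move/clA => [x [Ax [/pe[_ +] px]]] => /(_ px); exists x.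
Unshelve. all: by end_near. Qed.

Theorem proposition1 (R : realType) :
  ~ stratifiable R (kolmogorov_sorgenfrey R) (sorgenfrey_family R)
      (sorgenfrey_family_open R).
Proof.
move=> [f [f01 fE fle fc]].
pose I (x : R) : set (sorgenfrey R) := `[x, x + 1[%classic.
have famI x : sorgenfrey_family R (I x).
  by left; exists x, (x + 1); split=> //; rewrite ltrDl.
pose A n := [set x : R | n.+1%:R^-1 < f (I x) x].
have [n Ain0] : exists n, (closure (A n))^° !=set0.
  apply: Baire_cover; apply/seteqP; split=> // x _.
  have : I x x by rewrite /I /= in_itv /= lexx ltrDl ltr01.
  rewrite (fE _ (famI x)) /= in_itv /= => /andP[fx0 _].
  by have [n] := ltr_add_invr fx0; rewrite add0r => fxn; exists n.
have [p Ap] := ratr_dense_open _ _ (open_interior _) Ain0.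
(* The length 2 leaves room for [x, x + 1) whenever p < x < p + 1, and keeps the right endpoint
   rational. *)
pose U : set (sorgenfrey R) := `](ratr p : R), ratr (p + 2)[%classic.
have famU : sorgenfrey_family R U by right; exists p, (p + 2).
have fUp : f U (ratr p) = 0.
  have /andP[fp0 fp1] := f01 _ famU (ratr p : R).
  apply/eqP; rewrite eq_le fp0 andbT leNgt; apply/negP => fp.
  have : U (ratr p) by rewrite (fE _ famU) /= in_itv /= fp.
  by rewrite /U /= in_itv /= ltxx.
(* Only the right-hand limit is available, as [f U] is continuous for the Sorgenfrey topology. *)
have fU0 : f U x @[x --> (ratr p : R)^'+] --> (0 : R).
  rewrite -fUp => W /(fc _ famU (ratr p : R)).
  exact: cvg_sorgenfrey_at_right.
have [|x Ax [px xp fUx]] := @closure_at_right R (A n)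
    [set x | [/\ ratr p < x, x < ratr p + 1 & f U x < n.+1%:R^-1]] _ Ap.
  near=> x; split; near: x.
  - exact: nbhs_right_gt.
  - by apply: nbhs_right_lt; rewrite ltrDl.
  - by apply: cvgr_lt fU0 _ _; rewrite invr_gt0.
have IU : I x `<=` U.
  move=> t; rewrite /I /U /= !in_itv /= => /andP[xt tx].
  rewrite (lt_le_trans px xt) (lt_trans tx)// rmorphD/= ratr_nat.
  by rewrite -[2%:R](natrD _ 1 1) natrD addrA ltrD2r.
have := le_lt_trans (fle _ _ (famI x) famU IU x) fUx.
by rewrite ltNge (ltW Ax).
Unshelve. all: by end_near. Qed.
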